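(* Let $\mathcal A$ be a commutative C*-algebra with unit $e$ and let $\mathcal M$ be a full Hilbert $\mathcal A$-module. Then each derivation on $\mathrm{End}_{\mathcal A}(\mathcal M)$ is an inner derivation; that is, for every derivation $d:\mathrm{End}_{\mathcal A}(\mathcal M)\to \mathrm{End}_{\mathcal A}(\mathcal M)$ there is $T\in \mathrm{End}_{\mathcal A}(\mathcal M)$ such that $d(A)=TA-AT$ for all $A\in \mathrm{End}_{\mathcal A}(\mathcal M)$.
   Context: C*-algebras are complex. A Hilbert $\mathcal A$-module is a left $\mathcal A$-module $\mathcal M$ with an $\mathcal A$-valued inner product $\langle\cdot,\cdot\rangle:\mathcal M\times\mathcal M\to\mathcal A$ satisfying, for $\lambda\in\mathbb C$, $a\in\mathcal A$, $x,y,z\in\mathcal M$: $\langle x,x\rangle\ge 0$, and $\langle x,x\rangle=0$ implies $x=0$; $\langle\lambda x+y,z\rangle=\lambda\langle x,z\rangle+\langle y,z\rangle$; $\langle ax,y\rangle=a\langle x,y\rangle$; $\langle x,y\rangle=\langle y,x\rangle^*$; and such that $\mathcal M$ is complete for the norm $\|x\|=\|\langle x,x\rangle\|^{1/2}$. $\mathcal M$ is full if the closed linear span of $\{\langle x,y\rangle:x,y\in\mathcal M\}$ equals $\mathcal A$. A linear map $T:\mathcal M\to\mathcal M$ is $\mathcal A$-linear if $T(ax)=aT(x)$ for all $a\in\mathcal A$, $x\in\mathcal M$. $\mathrm{End}_{\mathcal A}(\mathcal M)$ is the Banach algebra (operator norm, composition) of all bounded $\mathcal A$-linear maps $\mathcal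 M\to\mathcal M$. A derivation on an algebra $\mathcal B$ is a ($\mathbb C$-)linear map $d:\mathcal B\to\mathcal B$ with $d(xy)=d(x)y+xd(y)$ for all $x,y\in\mathcal B$ (no continuity or $\mathcal A$-linearity assumed). A derivation is inner if it has the form $x\mapsto mx-xm$ for some fixed $m\in\mathcal B$. *)

(* Defs.v *)
From HB Require Import structures.
From mathcomp Require Import all_boot all_order all_algebra complex.
From mathcomp Require Import all_classical all_reals topology normedtype.

Set Implicit Arguments.
Unset Strict Implicit.
Unset Printing Implicit Defensive.

Import Order.TTheory GRing.Theory Num.Theory.
Import numFieldNormedType.Exports.

Local Open Scope classical_set_scope.
Local Open Scope complex_scope.
Local Open Scope ring_scope.

(* The multiplication and the unit are fields of the mixin; the [pzRingType]
   instance below gives them the usual ring notations (a [pzRingType] may be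
   trivial, so the zero algebra is allowed).  The norm of a normed module over
   [R[i]] is a nonnegative, hence real, element of [R[i]]. *)
HB.mixin Record isCStarAlgebra (R : realType) A
    & CompleteNormedModule R[i] A := {
  cstar_one : A;
  cstar_mul : A -> A -> A;
  star : A -> A;
  cstar_mulA : associative cstar_mul;
  cstar_mul1l : left_id cstar_one cstar_mul;
  cstar_mul1r : right_id cstar_one cstar_mul;
  cstar_mulDl : left_distributive cstar_mul +%R;
  cstar_mulDr : right_distributive cstar_mul +%R;
  cstar_scaleAl : forall (l : R[i]) (a b : A),
    l *: cstar_mul a b = cstar_mul (l *: a) b;
  cstar_scaleAr : forall (l : R[i]) (a b : A),
    l *: cstar_mul a b = cstar_mul a (l *: b);
  starK : involutive star;
  starD : {morph star : a b / a + b};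
  starZ : forall (l : R[i]) (a : A), star (l *: a) = Num.conj l *: star a;
  starM : forall a b : A, star (cstar_mul a b) = cstar_mul (star b) (star a);
  cstar_normM : forall a b : A, `|cstar_mul a b| <= `|a| * `|b| :> R[i];
  cstar_norm : forall a : A, `|cstar_mul (star a) a| = `|a| ^+ 2 :> R[i]
}.

#[short(type="cstarAlgType")]
HB.structure Definition CStarAlgebra (R : realType) :=
  {A of CompleteNormedModule R[i] A & isCStarAlgebra R A}.

HB.instance Definition _ (R : realType) (A : cstarAlgType R) :=
  GRing.Zmodule_isPzRing.Build A
    cstar_mulA cstar_mul1l cstar_mul1r cstar_mulDl cstar_mulDr.

Section positivity.
Variables (R : realType) (A : cstarAlgType R).

Definition invertible (a : A) := exists b : A, a * b = 1 /\ b * a = 1.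

Definition spectrum (a : A) : set R[i] :=
  [set l : R[i] | ~ invertible (a - l *: (1 : A))].

(* In [R[i]], [0 <= l] means that [l] is real and nonnegative. *)
Definition cstar_positive (a : A) :=
  star a = a /\ (forall l, spectrum a l -> 0 <= l).

End positivity.

(* The norm of the underlying complete normed space is required to be the one
   induced by the inner product, so that completeness refers to that norm. *)
HB.mixin Record isHilbertModule (R : realType) (A : cstarAlgType R) M
    & CompleteNormedModule R[i] M := {
  hact : A -> M -> M;
  inner : M -> M -> A;
  hactDl : forall (a b : A) (x : M), hact (a + b) x = hact a x + hact b x;
  hactDr : forall (a : A) (x y : M), hact a (x + y) = hact a x + hact a y;
  hactM : forall (a b : A) (x : M), hact (a * b) x = hact a (hact b x);
  hact1 : forall x : M, hact 1 x = x;
  hactZl : forall (l : R[i]) (a : A) (x : M), hact (l *: a) x = l *: hact a x;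
  hactZr : forall (l : R[i]) (a : A) (x : M), hact a (l *: x) = l *: hact a x;
  inner_ge0 : forall x : M, cstar_positive (inner x x);
  inner_eq0 : forall x : M, inner x x = 0 -> x = 0;
  inner_linear : forall (l : R[i]) (x y z : M),
    inner (l *: x + y) z = l *: inner x z + inner y z;
  inner_hact : forall (a : A) (x y : M), inner (hact a x) y = a * inner x y;
  inner_star : forall x y : M, inner x y = star (inner y x);
  hilbert_norm : forall x : M, `|x| = sqrtC `|inner x x| :> R[i]
}.

#[short(type="hilbertModType")]
HB.structure Definition HilbertModule (R : realType) (A : cstarAlgType R) :=
  {M of CompleteNormedModule R[i] M & isHilbertModule R A M}.

Section hilbert_module.
Variables (R : realType) (A : cstarAlgType R) (M : hilbertModType A).

Definition inner_span : set A :=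
  [set a | exists (n : nat) (l : 'I_n -> R[i]) (x y : 'I_n -> M),
     a = \sum_(i < n) l i *: inner (x i) (y i)].

Definition full := closure inner_span = [set: A].

Definition is_hmod_endo (T : M -> M) : Prop :=
  [/\ linear T,
      (forall (a : A) (x : M), T (hact a x) = hact a (T x)) &
      (exists k : R[i], forall x : M, `|T x| <= k * `|x|)].

Definition hmod_endo_pred : {pred (M -> M)} := [pred T | `[< is_hmod_endo T >]].

End hilbert_module.
Arguments full {R A} M.

Section hmod_endo.
Variables (R : realType) (A : cstarAlgType R) (M : hilbertModType A).

Record hmod_endo := HmodEndo {
  hmod_fun :> M -> M;
  hmod_funP : hmod_fun \in @hmod_endo_pred R A M
}.

HB.instance Definition _ := [isSub for hmod_fun].
HB.instance Definition _ := [Choice of hmod_endo by <:].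

End hmod_endo.
Arguments hmod_endo {R A} M.
Notation "''End_' A ( M )" := (@hmod_endo _ A M)
  (at level 8, A at level 2, format "''End_' A ( M )") : type_scope.

Section hmod_endo_algebra.
Variables (R : realType) (A : cstarAlgType R) (M : hilbertModType A).

Lemma hmod_endoP (T : 'End_A(M)) : is_hmod_endo (T : M -> M).
Proof. exact/asboolP/(hmod_funP T). Qed.

Lemma hact0r (a : A) : hact a (0 : M) = 0.
Proof. by apply: (addrI (hact a (0 : M))); rewrite -hactDr !addr0. Qed.

Fact hmod_endo_submod_closed : submod_closed (@hmod_endo_pred R A M).
Proof.
split.
  apply/asboolP; split=> [l x y|a x|].
  - by rewrite /= scaler0 addr0.
  - by rewrite /= hact0r.
  - by exists 0 => x; rewrite /= normr0 mul0r.
move=> c S T /asboolP[linS actS [k kS]] /asboolP[linT actT [h hT]].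
have cSTE x : (c *: S + T) x = c *: S x + T x by [].
apply/asboolP; split=> [l x y|a x|].
- rewrite !cSTE linS linT !scalerDr !scalerA [c * l]mulrC -!addrA.
  by congr (_ + _); rewrite addrCA.
- by rewrite !cSTE actS actT hactDr hactZr.
exists (`|c| * k + h) => x; rewrite cSTE mulrDl.
rewrite (le_trans (ler_normD _ _))// lerD// normrZ -mulrA.
exact: ler_wpM2l.
Qed.

HB.instance Definition _ := GRing.isSubmodClosed.Build R[i] (M -> M)
  (@hmod_endo_pred R A M) hmod_endo_submod_closed.
HB.instance Definition _ := [SubChoice_isSubLmodule of 'End_A(M) by <:].

Fact hmod_endo_id : (id : M -> M) \in @hmod_endo_pred R A M.
Proof.
by apply/asboolP; split=> //; exists 1 => x; rewrite mul1r.
Qed.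

Fact hmod_endo_comp (S T : 'End_A(M)) :
  (fun x => S (T x)) \in @hmod_endo_pred R A M.
Proof.
have [linS actS [k kS]] := hmod_endoP S.
have [linT actT [h hT]] := hmod_endoP T.
apply/asboolP; split=> [l x y|a x|].
- by rewrite linT linS.
- by rewrite actT actS.
have [M0|] := pselect (forall x : M, x = 0).
  exists 0 => x; rewrite mul0r (M0 (S _)) normr0; exact: lexx.
move=> /existsNP[z /eqP z0]; have z_gt0 : 0 < `|z| by rewrite normr_gt0.
have k0 : 0 <= k by rewrite -(pmulr_lge0 _ z_gt0) (le_trans _ (kS z)).
exists (k * h) => x; rewrite (le_trans (kS _))// -mulrA.
exact: ler_wpM2l.
Qed.

Definition hmod_endo_one : 'End_A(M) := HmodEndo hmod_endo_id.
Definition hmod_endo_mul (S T : 'End_A(M)) : 'End_A(M) :=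
  HmodEndo (hmod_endo_comp S T).

Fact hmod_endo_mulA : associative hmod_endo_mul.
Proof. by move=> S T U; exact: val_inj. Qed.
Fact hmod_endo_mul1 : left_id hmod_endo_one hmod_endo_mul.
Proof. by move=> S; exact: val_inj. Qed.
Fact hmod_endo_mulr1 : right_id hmod_endo_one hmod_endo_mul.
Proof. by move=> S; exact: val_inj. Qed.
Fact hmod_endo_mulDl : left_distributive hmod_endo_mul +%R.
Proof. by move=> S T U; exact: val_inj. Qed.
Fact hmod_endo_mulDr : right_distributive hmod_endo_mul +%R.
Proof.
move=> S T U; apply: val_inj; apply: funext => x /=.
have [linS _ _] := hmod_endoP S.
by have := linS 1 (T x) (U x); rewrite !scale1r.
Qed.

HB.instance Definition _ := GRing.Zmodule_isPzRing.Build 'End_A(M)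
  hmod_endo_mulA hmod_endo_mul1 hmod_endo_mulr1
  hmod_endo_mulDl hmod_endo_mulDr.

Lemma hmod_endoM (S T : 'End_A(M)) (x : M) : (S * T) x = S (T x).
Proof. by []. Qed.
Lemma hmod_endo1 (x : M) : (1 : 'End_A(M)) x = x.
Proof. by []. Qed.
Lemma hmod_endoD (S T : 'End_A(M)) (x : M) : (S + T) x = S x + T x.
Proof. by []. Qed.
Lemma hmod_endoN (S : 'End_A(M)) (x : M) : (- S) x = - S x.
Proof. by []. Qed.
Lemma hmod_endoZ (l : R[i]) (S : 'End_A(M)) (x : M) : (l *: S) x = l *: S x.
Proof. by []. Qed.

Definition derivation (d : 'End_A(M) -> 'End_A(M)) :=
  linear d /\ forall S T, d (S * T) = d S * T + S * d T.

Definition inner_derivation (d : 'End_A(M) -> 'End_A(M)) :=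
  exists T : 'End_A(M), forall S, d S = T * S - S * T.

End hmod_endo_algebra.

(* Main.v *)
(* Fullness gives finitely many [z i], [y i] with
   [\sum_i inner (z i) (y i) = 1].  Writing [theta u v] for the rank one
   operator [x |-> inner x v u], the map [T x = \sum_i d (theta x (y i)) (z i)]
   satisfies [d S = T S - S T], because [S (theta u v) = theta (S u) v].  It is
   [A]-linear provided [d] kills the scalar operators [x |-> a x]; they are
   central, so [d] restricts there to a derivation of [A], and every derivation
   of [A] vanishes.  Boundedness of [T] comes from the identity
   [inner (T x) v u = inner x v (T u) - d (theta u v) x] and the uniform
   boundedness principle.

   Characters are replaced by C*-seminorms [N] on [A]: given a self-adjoint
   [x], any [N] can be decreased to a C*-seminorm [N'] for which [x] is at
   distance 0 from a scalar.  This suffices for the Cauchy-Schwarz inequality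
   and for evaluating a derivation at a point: if a unitary [u] is at
   [N]-distance 0 from the scalar [l], then [u = l (1 - w^2)] with [w] null for
   [N], so that the derivative of [u] is null as well. *)

Require Import Defs.
From mathcomp Require Import all_boot all_order all_algebra.
From mathcomp Require Import all_classical all_reals.
From HB Require Import structures.
From mathcomp Require Import complex topology normedtype ring lra.

Set Implicit Arguments.
Unset Strict Implicit.
Unset Printing Implicit Defensive.

Import Order.TTheory GRing.Theory Num.Theory.
Import numFieldNormedType.Exports.

Local Open Scope classical_set_scope.
Local Open Scope complex_scope.
Local Open Scope ring_scope.

(** * Real-valued norms *)

Section real_norm.
Variable R : realType.

(** Norms live in [R[i]], which is only partially ordered; values in [R] give access to infima,
    suprema and [lra]. *)
Definition nr (V : normedZmodType R[i]) (x : V) : R := complex.Re `|x|.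

Lemma nrE (V : normedZmodType R[i]) (x : V) : `|x| = (nr x)%:C.
Proof. by rewrite RRe_real// normr_real. Qed.

Lemma nr_ge0 (V : normedZmodType R[i]) (x : V) : 0 <= nr x.
Proof. by rewrite -ler0c -nrE. Qed.

Lemma nr0 (V : normedZmodType R[i]) : nr (0 : V) = 0.
Proof. by rewrite /nr normr0. Qed.

Lemma nr_eq0 (V : normedZmodType R[i]) (x : V) : nr x = 0 -> x = 0.
Proof. by move=> x0; apply/normr0_eq0; rewrite nrE x0. Qed.

Lemma nrD (V : normedZmodType R[i]) (x y : V) : nr (x + y) <= nr x + nr y.
Proof. by rewrite -lecR rmorphD/= -!nrE; exact: ler_normD. Qed.

Lemma nrN (V : normedZmodType R[i]) (x : V) : nr (- x) = nr x.
Proof. by rewrite /nr normrN. Qed.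

Lemma nrZ (V : normedModType R[i]) (l : R[i]) (x : V) :
  nr (l *: x) = nr l * nr x.
Proof. by apply: complexI; rewrite rmorphM/= -!nrE normrZ. Qed.

Lemma nrM (l m : R[i]) : nr (l * m) = nr l * nr m.
Proof. by apply: complexI; rewrite rmorphM/= -!nrE normrM. Qed.

Lemma nrR (r : R) : nr (r%:C : R[i]) = `|r|.
Proof. by apply: complexI; rewrite -nrE normc_def/= expr0n addr0 sqrtr_sqr. Qed.

Lemma nr_conj (l : R[i]) : nr (Num.conj l) = nr l.
Proof. by rewrite /nr norm_conjC. Qed.

Lemma nr_sqr (l : R[i]) : Num.conj l * l = (nr l ^+ 2)%:C.
Proof. by rewrite rmorphXn/= -nrE mulrC normCK. Qed.

Lemma nr_sum (V : normedZmodType R[i]) (n : nat) (F : 'I_n -> V) :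
  nr (\sum_(i < n) F i) <= \sum_(i < n) nr (F i).
Proof.
elim/big_ind2: _ => [|x1 x2 y1 y2 h1 h2|//]; first by rewrite nr0.
exact: le_trans (nrD _ _) (lerD h1 h2).
Qed.

End real_norm.

(** * Limits by real majorants *)

Section convergence.
Variables (R : realType) (V : completeNormedModType R[i]).

Lemma nr_cauchy_cvg (y : nat -> V) :
  (forall e : R, 0 < e -> exists n0, forall n, (n0 <= n)%N ->
     nr (y n - y n0) <= e) ->
  exists l : V, forall e : R, 0 < e -> exists n0, forall n, (n0 <= n)%N ->
    nr (y n - l) <= e.
Proof.
move=> yC; have : cauchy (y @ \oo).
  apply: cauchy_exP => e e0.
  have [eR Re0] : e = (complex.Re e)%:C /\ 0 < complex.Re e.
    have eE := RRe_real (gtr0_real e0); split; first by rewrite eE.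
    by rewrite -(ltcR 0) eE.
  have [n0 yn0] := yC _ (divr_gt0 Re0 (ltr0Sn R 1)).
  exists (y n0); exists n0 => // n /= n0n.
  rewrite -ball_normE /ball_/= distrC nrE eR ltcR.
  by rewrite (le_lt_trans (yn0 _ n0n))// ltr_pdivrMr// mulr_natr mulr2n ltrDl.
move=> /cauchy_cvg/cvg_ex[l yl]; exists l => e e0.
have e0C : 0 < e%:C :> R[i] by rewrite (ltcR 0).
move/cvgrPdist_le : yl => /(_ _ e0C)[n0 _ yn0].
exists n0 => n n0n; rewrite -lecR -nrE distrC; exact: yn0.
Qed.

(** The majorant [r] is nondecreasing and bounded, so its late increments are small and control
    those of [y]. The square root, the Neumann series and the gliding hump all converge this way. *)
Lemma nr_dominated_cvg (y : nat -> V) (r : nat -> R) (B : R) :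
  (forall n, nr (y n.+1 - y n) <= r n.+1 - r n) -> (forall n, r n <= B) ->
  exists l : V, (forall n, nr (y n - l) <= B - r n) /\
    forall e : R, 0 < e -> exists n0, forall n, (n0 <= n)%N ->
      nr (y n - l) <= e.
Proof.
move=> yr rB; have yrD m k : nr (y (k + m)%N - y m) <= r (k + m)%N - r m.
  elim: k => [|k IH]; first by rewrite !subrr nr0.
  rewrite addSn -[X in nr X](subrKA (y (k + m)%N)).
  rewrite -[leRHS](subrKA (r (k + m)%N)).
  exact: le_trans (nrD _ _) (lerD (yr _) IH).
have [l yl] : exists l : V, forall e : R, 0 < e ->
    exists n0, forall n, (n0 <= n)%N -> nr (y n - l) <= e.
  apply: nr_cauchy_cvg => e e0.
  have r_sup : has_sup (range r).
    split; first by exists (r 0), 0.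
    by exists B => _ [n _ <-].
  have [_ [n0 _ <-] n0e] := sup_adherent e0 r_sup.
  exists n0 => n /subnK <-; rewrite (le_trans (yrD _ _))//.
  rewrite lerBlDl -lerBlDr (le_trans _ (ltW n0e))// lerD2r.
  by apply: ub_le_sup; [exists B => _ [k _ <-]|exists (n - n0 + n0)%N].
exists l; split=> // n; apply/ler_addgt0Pr => e /yl[n0 yn].
rewrite -[X in nr X](subrKA (y (n0 + n)%N)) (le_trans (nrD _ _))//.
rewrite lerD ?yn ?leq_addr// -nrN opprB (le_trans (yrD _ _))//.
by rewrite lerB.
Qed.

Lemma nr_le_eps (x : V) (C : R) :
  (forall e, 0 < e -> nr x <= C * e) -> x = 0.
Proof.
move=> H; apply: nr_eq0; apply/eqP; rewrite eq_le nr_ge0 andbT.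
apply/ler_addgt0Pr => e e0; rewrite add0r.
have C1 : 0 < `|C| + 1 by rewrite ltr_wpDl.
rewrite (le_trans (H _ (divr_gt0 e0 C1)))// mulrA ler_pdivrMr// mulrC.
by rewrite ler_wpM2l ?(ltW e0)// (le_trans (ler_norm C))// lerDl.
Qed.

End convergence.

(** * Elementary C*-algebra identities *)

Section cstar_basics.
Variables (R : realType) (A : cstarAlgType R).
Implicit Types (a b x y z : A) (l : R[i]).

Lemma scaleAl l a b : (l *: a) * b = l *: (a * b).
Proof. exact/esym/cstar_scaleAl. Qed.

Lemma scaleAr l a b : a * (l *: b) = l *: (a * b).
Proof. exact/esym/cstar_scaleAr. Qed.

Lemma star_mul a b : star (a * b) = star b * star a.
Proof. exact: starM. Qed.

Lemma star0 : star (0 : A) = 0.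
Proof. by apply: (addrI (star 0)); rewrite -starD !addr0. Qed.

Lemma starN a : star (- a) = - star a.
Proof. by apply/eqP; rewrite -addr_eq0 -starD addNr star0. Qed.

Lemma starB a b : star (a - b) = star a - star b.
Proof. by rewrite starD starN. Qed.

Lemma star1 : star (1 : A) = 1.
Proof. by rewrite -[LHS]mulr1 -[X in _ * X]starK -star_mul mulr1 starK. Qed.

Lemma star_expr a n : star (a ^+ n) = star a ^+ n.
Proof.
by elim: n => [|n IH]; rewrite ?expr0 ?star1// exprS star_mul IH -exprSr.
Qed.

Lemma star_real (r : R) a : star (r%:C *: a) = r%:C *: star a.
Proof.
by rewrite starZ conj_Creal//; apply/complex_realP; exists r.
Qed.

Lemma nr_mul a b : nr (a * b) <= nr a * nr b.
Proof. by rewrite -lecR rmorphM/= -!nrE; exact: cstar_normM. Qed.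

Lemma nr_starM a : nr (star a * a) = nr a ^+ 2.
Proof. by apply: complexI; rewrite rmorphXn/= -!nrE; exact: cstar_norm. Qed.

Lemma nr_star a : nr (star a) = nr a.
Proof.
suff le b : nr b <= nr (star b).
  by apply/eqP; rewrite eq_le le andbT -{2}[a]starK le.
have [b0|b0] := eqVneq (nr b) 0; first by rewrite b0 nr_ge0.
have b_gt0 : 0 < nr b by rewrite lt_def b0 nr_ge0.
by rewrite -(ler_pM2r b_gt0) -expr2 -nr_starM nr_mul.
Qed.

Lemma nr1 : (1 : A) != 0 -> nr (1 : A) = 1.
Proof.
move=> /eqP A1; have n0 : nr (1 : A) != 0 by apply/eqP => /nr_eq0.
by apply: (mulfI n0); rewrite mulr1 -expr2 -nr_starM star1 mulr1.
Qed.

End cstar_basics.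

(* [commA] as a canonical structure, for the [ring] tactic. *)
Definition comm_cstar (R : realType) (A : cstarAlgType R)
    (commA : forall a b : A, a * b = b * a) : comPzRingType :=
  HB.pack (CStarAlgebra.sort A) (GRing.PzRing_hasCommutativeMul.Build A commA).

(** * C*-seminorms and derivations of a commutative C*-algebra *)

Section seminorm.
Variables (R : realType) (A : cstarAlgType R).
Hypothesis commA : forall a b : A, a * b = b * a.
Implicit Types (a b g h x y z : A) (l : R[i]) (N : A -> R).

Let cA := comm_cstar commA.

Lemma comm_sqrB x y : (x - y) * (x + y) = x * x - y * y.
Proof.
suff E (u v : cA) : (u - v) * (u + v) = u * u - v * v by exact: E.
by ring.
Qed.

Lemma comm_mulACA x y z t : x * y * (z * t) = x * z * (y * t).
Proof.
suff E (u v w s : cA) : u * v * (w * s) = u * w * (v * s) by exact: E.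
by ring.
Qed.

Lemma comm_mulCA x y z : x * (y * z) = y * (x * z).
Proof. by rewrite !mulrA (commA x). Qed.

(** In Gelfand's picture, [N] is the supremum of absolute values over a closed set of characters,
    which [csn1] keeps nonempty; a smaller [N] means a smaller set. *)
Record cstar_seminorm N : Prop := CstarSeminorm {
  csnD : forall x y, N (x + y) <= N x + N y;
  csnZ : forall l x, N (l *: x) = nr l * N x;
  csnM : forall x y, N (x * y) <= N x * N y;
  csn_starM : forall x, N (star x * x) = N x ^+ 2;
  csn1 : N 1 = 1;
  csn_le : forall x, N x <= nr x }.

Lemma csn_nr : (1 : A) != 0 -> cstar_seminorm (fun x => nr x).
Proof.
move=> A1; split=> // [x y|l x|x y|x|]; first exact: nrD.
- exact: nrZ.
- exact: nr_mul.
- exact: nr_starM.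
- exact: nr1.
Qed.

Section theory.
Variable N : A -> R.
Hypothesis csN : cstar_seminorm N.

Lemma csn0 : N 0 = 0.
Proof. by rewrite -(scale0r (0 : A)) (csnZ csN) nr0 mul0r. Qed.

Lemma csnZR (r : R) x : N (r%:C *: x) = `|r| * N x.
Proof. by rewrite (csnZ csN) nrR. Qed.

Lemma csnN x : N (- x) = N x.
Proof.
rewrite -scaleN1r (csnZ csN) nrN.
by have := nrR (1 : R); rewrite normr1 => ->; rewrite mul1r.
Qed.

Lemma csn_ge0 x : 0 <= N x.
Proof.
have := csnD csN x (- x); rewrite subrr csn0 csnN -mulr2n.
by rewrite pmulrn_lge0.
Qed.

Lemma csnB x y : N (x - y) <= N x + N y.
Proof. by rewrite -(csnN y) (csnD csN). Qed.

Lemma csn_star x : N (star x) = N x.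
Proof.
suff le b : N b <= N (star b).
  by apply/eqP; rewrite eq_le le andbT -{2}[x]starK le.
have [b0|b0] := eqVneq (N b) 0; first by rewrite b0 csn_ge0.
have b_gt0 : 0 < N b by rewrite lt_def b0 csn_ge0.
by rewrite -(ler_pM2r b_gt0) -expr2 -(csn_starM csN) (csnM csN).
Qed.

Lemma csn_null_mul x y : N x = 0 -> N (x * y) = 0.
Proof.
move=> x0; apply/eqP; rewrite eq_le csn_ge0 andbT.
by rewrite (le_trans (csnM csN _ _))// x0 mul0r.
Qed.

Lemma csn_nullD x y : N x = 0 -> N y = 0 -> N (x + y) = 0.
Proof.
move=> x0 y0; apply/eqP; rewrite eq_le csn_ge0 andbT.
by rewrite (le_trans (csnD csN _ _))// x0 y0 addr0.
Qed.

Lemma csn_nullZ l x : N x = 0 -> N (l *: x) = 0.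
Proof. by move=> x0; rewrite (csnZ csN) x0 mulr0. Qed.

Lemma csn_null_eq x y : N (x - y) = 0 -> N x = N y.
Proof.
move=> xy0; apply/eqP; rewrite eq_le; apply/andP; split.
  by have := csnD csN (x - y) y; rewrite subrK xy0 add0r.
by have := csnD csN (y - x) x; rewrite subrK -opprB csnN xy0 add0r.
Qed.

(** Applying the C*-identity twice writes the fourth power of [N x] as the seminorm of a product
    from which commutativity extracts the factor [x * x]. *)
Lemma csn_null_sqr x : N (x * x) = 0 -> N x = 0.
Proof.
move=> xx0.
have : N x ^+ 2 ^+ 2 = 0.
  rewrite -!(csn_starM csN) star_mul starK commA comm_mulACA -commA.
  by rewrite [_ * (x * x)]commA; exact: csn_null_mul.
by move/eqP; rewrite !sqrf_eq0 => /eqP.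
Qed.

Lemma csn_sqr x : star x = x -> N (x * x) = N x ^+ 2.
Proof. by move=> xs; rewrite -(csn_starM csN) xs. Qed.

Lemma csn_expr_le1 x n : N x <= 1 -> N (x ^+ n) <= 1.
Proof.
move=> x1; elim: n => [|n IH]; first by rewrite expr0 (csn1 csN).
rewrite exprS (le_trans (csnM csN _ _))// mulr_ile1 ?csn_ge0//.
Qed.

Lemma csn_expr1 x n : star x = x -> N x = 1 -> N (x ^+ n) = 1.
Proof.
move=> xs x1; have pow2 k : N (x ^+ (2 ^ k)) = 1.
  elim: k => [|k IH]; first by rewrite expn0 expr1.
  rewrite expnS mul2n -addnn exprD csn_sqr ?IH ?expr1n//.
  by rewrite star_expr xs.
apply/eqP; rewrite eq_le csn_expr_le1 ?x1//= -(pow2 n).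
(* Since [n <= 2 ^ n], the power [x ^+ n] divides one of seminorm 1, with cofactor of seminorm at
   most 1. *)
have /subnK <- := ltnW (ltn_expl n (ltnSn 1)).
rewrite exprD (le_trans (csnM csN _ _))//.
by rewrite ler_piMl ?csn_ge0 ?csn_expr_le1 ?x1.
Qed.

(** By the C*-identity both squares are the seminorm of the same product of [x], [z] and their
    adjoints. *)
Lemma csn_mul_star x z : N (star x * z) = N (x * z).
Proof.
have E s : N (s * z) ^+ 2 = N (star z * z * (star s * s)).
  rewrite -(csn_starM csN) star_mul.
  by rewrite [s * z]commA comm_mulACA.
apply/eqP; rewrite -(eqrXn2 (n := 2))// ?csn_ge0// !E starK.
by rewrite (commA x).
Qed.

(* With [e = 'i *: c] one has [4 e = (1 + e)^2 - (1 - e)^2], and both squares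
   have the same seminorm as [(1 + e)^* (1 + e) = 1 + c^2]. *)
Lemma csn_amgm c z : star c = c -> 2 * N (c * z) <= N ((1 + c * c) * z).
Proof.
move=> cs; pose e := 'i *: c.
have es : star e = - e by rewrite starZ conjCi cs scaleNr.
have e2 : e * e = - (c * c).
  by rewrite scaleAl scaleAr scalerA -expr2 sqrCi scaleN1r.
have s1 : star (1 + e) = 1 - e by rewrite starD star1 es.
have s2 : star (1 - e) = 1 + e by rewrite starB star1 es opprK.
have N1 : N ((1 + e) * ((1 + e) * z)) = N ((1 + c * c) * z).
  by rewrite -csn_mul_star s1 mulrA comm_sqrB mulr1 e2 opprK.
have N2 : N ((1 - e) * ((1 - e) * z)) = N ((1 + c * c) * z).
  rewrite -(csn_mul_star (1 - e)) s2 mulrA (commA (1 + e)) comm_sqrB mulr1 e2.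
  by rewrite opprK.
have E : (e * z) *+ 4 =
    (1 + e) * ((1 + e) * z) - (1 - e) * ((1 - e) * z).
  suff E (u w : cA) : (u * w) *+ 4 =
    (1 + u) * ((1 + u) * w) - (1 - u) * ((1 - u) * w) by exact: E.
  by ring.
have := csnB ((1 + e) * ((1 + e) * z)) ((1 - e) * ((1 - e) * z)).
rewrite -E N1 N2 -scaler_nat (csnZ csN) scaleAl (csnZ csN).
have -> : nr ('i : R[i]) = 1 by rewrite /nr normCi.
have -> : nr (4%:R : R[i]) = 4.
  by rewrite /nr normr_nat -(rmorph_nat (real_complex R)).
by move=> H; lra.
Qed.

(** * Decreasing a C*-seminorm by a set of weights *)

Section localisation.
Variable G : set A.
Hypothesis G1 : G 1.
Hypothesis GM : forall g h, G g -> G h -> G (g * h).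
Hypothesis Gs : forall g, G g -> star g = g.
Hypothesis GN : forall g, G g -> N g = 1.

(** In terms of characters, products of weights suppress every character at which some weight has
    modulus below 1. *)
Definition csn_inf z : R := inf [set N (g * z) | g in G].

Let has_lb z : has_lbound [set N (g * z) | g in G].
Proof. by exists 0 => _ [g _ <-]; exact: csn_ge0. Qed.

Lemma csn_inf_le g z : G g -> csn_inf z <= N (g * z).
Proof. by move=> Gg; apply: ge_inf => //; exists g. Qed.

Let inf_ge z r : (forall g, G g -> r <= N (g * z)) -> r <= csn_inf z.
Proof.
move=> H; apply: lb_le_inf; first by exists (N (1 * z)), 1.
by move=> _ [g Gg <-]; exact: H.
Qed.

Let inf_ge0 z : 0 <= csn_inf z.
Proof. by apply: inf_ge => g _; exact: csn_ge0. Qed.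

Let inf_mul z r c : 0 <= c -> (forall g, G g -> r <= N (g * z) * c) ->
  r <= csn_inf z * c.
Proof.
rewrite le_eqVlt => /orP[/eqP <-|c0] H.
  by have := H _ G1; rewrite !mulr0.
by rewrite -ler_pdivrMr//; apply: inf_ge => g /H; rewrite ler_pdivrMr.
Qed.

Let N_le g z : G g -> N (g * z) <= N z.
Proof. by move=> Gg; rewrite (le_trans (csnM csN _ _))// GN// mul1r. Qed.

Lemma csn_infP : cstar_seminorm csn_inf.
Proof.
have infZ l x : nr l * csn_inf x <= csn_inf (l *: x).
  apply: inf_ge => g Gg; rewrite scaleAr (csnZ csN).
  by rewrite ler_wpM2l ?nr_ge0 ?csn_inf_le.
split=> [x y|l x|x y|x||x].
- rewrite -lerBlDr; apply: inf_ge => g Gg.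
  rewrite lerBlDr -lerBlDl; apply: inf_ge => h Gh; rewrite lerBlDl.
  rewrite (le_trans (csn_inf_le _ (GM Gg Gh)))// mulrDr.
  rewrite (le_trans (csnD csN _ _))// lerD//.
    by rewrite (commA g) -mulrA N_le.
  by rewrite -mulrA N_le.
- apply/eqP; rewrite eq_le infZ andbT.
  have [->|l0] := eqVneq l 0.
    by rewrite scale0r nr0 mul0r -csn0 -[leRHS](congr1 N (mul1r 0)) csn_inf_le.
  have nl0 : 0 < nr l.
    by rewrite lt_def nr_ge0 andbT; apply: contra_neq l0 => /nr_eq0.
  have := infZ l^-1 (l *: x); rewrite scalerA mulVf// scale1r.
  have -> : nr l^-1 = (nr l)^-1.
    apply: (mulfI (lt0r_neq0 nl0)); rewrite -nrM mulfV// mulfV ?lt0r_neq0//.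
    by have := nrR (1 : R); rewrite normr1.
  by rewrite ler_pdivrMl.
- apply: inf_mul => // g Gg; rewrite mulrC; apply: inf_mul => [|h Gh].
    exact: csn_ge0.
  rewrite (le_trans (csn_inf_le _ (GM Gg Gh)))// comm_mulACA mulrC.
  exact: (csnM csN).
- apply/eqP; rewrite eq_le; apply/andP; split.
    rewrite expr2; apply: inf_mul => // g Gg; rewrite mulrC.
    apply: inf_mul => [|h Gh]; first exact: csn_ge0.
    rewrite (le_trans (csn_inf_le _ (GM Gg Gh)))// comm_mulACA mulrC.
    rewrite -(csn_star (g * x)) star_mul (Gs Gg) (commA (star x)).
    exact: (csnM csN).
  apply: inf_ge => g Gg; apply: (@le_trans _ _ (N (g * x) ^+ 2)).
    by rewrite ler_pXn2r ?nnegrE ?csn_ge0 ?inf_ge0 ?csn_inf_le.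
  rewrite -(csn_starM csN) star_mul (Gs Gg) (commA (star x)) -mulrA.
  by rewrite (comm_mulCA (star x)) N_le.
- apply/eqP; rewrite eq_le; apply/andP; split.
    by rewrite -[leRHS](csn1 csN) -[in leRHS](mul1r 1) csn_inf_le.
  by apply: inf_ge => g Gg; rewrite mulr1 GN.
- rewrite (le_trans (csn_inf_le _ G1))// mul1r; exact: (csn_le csN).
Qed.

End localisation.

End theory.

(* The weights [g] below are products of the elements [(1 + x^(2 j)) / 2]; by
   [csn_amgm] each of them dominates a power of [x], hence has seminorm 1, and
   the product over [j = 1, 2, 4, .., 2^(k-1)] times [1 - x^2] telescopes to
   [(1 - x^(2^(k+1))) / 2^k]. *)
Lemma csn_localise N x : cstar_seminorm N -> star x = x -> N x = 1 ->
  exists N', [/\ cstar_seminorm N', (forall z, N' z <= N z) &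
    N' (1 - x * x) = 0].
Proof.
move=> csN xs x1.
pose G : set A := [set g | [/\ star g = g, N g <= 1 &
  exists m, forall z, N (x ^+ m * z) <= N (g * z)]].
have G1 : G 1.
  split; rewrite ?star1 ?(csn1 csN)//.
  by exists 0 => z; rewrite expr0.
have GM g h : G g -> G h -> G (g * h).
  move=> [gs g1 [m gm]] [hs h1 [n hn]]; split.
  - by rewrite star_mul gs hs commA.
  - by rewrite (le_trans (csnM csN _ _))// mulr_ile1 ?(csn_ge0 csN).
  - exists (m + n)%N => z; rewrite exprD -mulrA (le_trans (gm _))//.
    by rewrite -mulrA !(comm_mulCA g); exact: hn.
have Gs g : G g -> star g = g by case.
have GN g : G g -> N g = 1.
  move=> [_ g1 [m /(_ 1)]]; rewrite !mulr1 (csn_expr1 csN)// => g1'.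
  by apply/eqP; rewrite eq_le g1.
pose half : R[i] := (2^-1 : R)%:C.
have Ghalf j : G (half *: (1 + x ^+ j * x ^+ j)).
  have xj : star (x ^+ j) = x ^+ j by rewrite star_expr xs.
  have h2 : `|2^-1 : R| = 2^-1 by rewrite ger0_norm ?invr_ge0.
  split.
  - by rewrite star_real starD star1 star_mul xj.
  - rewrite (csnZR csN) h2 ler_pdivrMl// mulr1.
    rewrite (le_trans (csnD csN _ _))// (csn1 csN) -exprD (csn_expr1 csN)//.
  - exists j => z; rewrite scaleAl (csnZR csN) h2 ler_pdivlMl//.
    exact: csn_amgm.
have tele k : exists g, G g /\
    g * (1 - x * x) = half ^+ k *: (1 - (x * x) ^+ (2 ^ k)).
  elim: k => [|k [g [Gg gE]]].
    by exists 1; split=> //; rewrite mul1r expr0 scale1r expn0 expr1.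
  exists (g * (half *: (1 + x ^+ (2 ^ k) * x ^+ (2 ^ k)))); split.
    exact: GM.
  rewrite (commA g) -mulrA gE scaleAl scaleAr scalerA -exprS; congr (_ *: _).
  have -> : x ^+ (2 ^ k) * x ^+ (2 ^ k) = (x * x) ^+ (2 ^ k).
    by rewrite -!expr2 -!exprM mulnC.
  by rewrite commA comm_sqrB mulr1 -exprD addnn -mul2n -expnS.
have csI := csn_infP csN G1 GM Gs GN.
exists (csn_inf N G); split=> // [z|].
  by rewrite -[leRHS](congr1 N (mul1r z)); exact: csn_inf_le.
apply/eqP; rewrite eq_le (csn_ge0 csI) andbT; apply/ler_addgt0Pr => e e0.
rewrite add0r.
have [k ke] : exists k : nat, 2 * (2^-1) ^+ k <= e.
  exists (Num.bound (2 / e)).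
  have := upper_nthrootP (leqnn (Num.bound (2 / e))).
  rewrite ltr_pdivrMr// => /ltW.
  by rewrite exprVn ler_pdivrMr ?exprn_gt0// mulrC.
have [g [Gg gE]] := tele k.
rewrite (le_trans (csn_inf_le csN _ Gg))// gE (le_trans _ ke)//.
rewrite -rmorphXn (csnZR csN) ger0_norm ?exprn_ge0 ?invr_ge0// mulrC.
rewrite ler_wpM2r ?exprn_ge0 ?invr_ge0//.
rewrite (le_trans (csnB csN _ _))// (csn1 csN) -expr2 -exprM.
by rewrite (csn_expr1 csN).
Qed.

Lemma csn_nullMn N x n : cstar_seminorm N -> N (x *+ n.+1) = 0 -> N x = 0.
Proof.
move=> csN /eqP; rewrite -scaler_nat (csnZ csN) mulf_eq0 => /orP[|/eqP//].
have -> : nr (n.+1%:R : R[i]) = n.+1%:R.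
  by rewrite /nr normr_nat -(rmorph_nat (real_complex R)).
by rewrite pnatr_eq0.
Qed.

Lemma csn_leq0 N N' x : cstar_seminorm N' -> (forall z, N' z <= N z) ->
  N x = 0 -> N' x = 0.
Proof.
move=> csN' le' x0; apply/eqP.
by rewrite eq_le (csn_ge0 csN') andbT -x0 le'.
Qed.

(** Localising at the normalisation [y] of [x] gives [y * y = 1] up to null elements, so
    [v = (1 + y) / 2] is idempotent there. Either [v] is null and [y] is [-1], or [v] has seminorm 1
    and localising at [v] makes [v], hence [y], equal to 1. *)
Lemma csn_scalar N x : cstar_seminorm N -> star x = x ->
  exists N' (t : R), [/\ cstar_seminorm N', (forall z, N' z <= N z) &
    N' (x - t%:C *: (1 : A)) = 0].
Proof.
move=> csN xs; have [x0|x0] := eqVneq (N x) 0.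
  by exists N, 0; split=> //; rewrite scale0r subr0.
have tau0 : 0 < N x by rewrite lt_def x0 csn_ge0.
pose y := (N x)^-1%:C *: x.
have xE : x = (N x)%:C *: y.
  by rewrite scalerA -rmorphM/= mulfV// scale1r.
have ys : star y = y by rewrite star_real xs.
have y1 : N y = 1 by rewrite (csnZR csN) ger0_norm ?invr_ge0 ?ltW// mulVf.
have [N1 [cs1 le1 yy0]] := csn_localise csN ys y1.
pose v := (2^-1 : R)%:C *: (1 + y).
have vv2 : v + v = 1 + y.
  rewrite -scalerDl -rmorphD/=.
  have -> : 2^-1 + 2^-1 = 1 :> R by lra.
  by rewrite scale1r.
have vs : star v = v by rewrite star_real starD star1 ys.
have yE : y = v + v - 1 by rewrite vv2 addrC addKr.
have e0 : N1 (v * v - v) = 0.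
  apply: (csn_nullMn (n := 3)) => //.
  suff -> : (v * v - v) *+ 4 = - (1 - y * y) by rewrite csnN.
  rewrite yE; suff E (a : cA) :
    (a * a - a) *+ 4 = - (1 - (a + a - 1) * (a + a - 1)) by exact: E.
  by ring.
have := csn_null_eq cs1 e0; rewrite csn_sqr//.
have [v0 _|v0] := eqVneq (N1 v) 0.
  exists N1, (- N x); split=> //.
  rewrite {1}xE rmorphN scaleNr opprK -scalerDr addrC.
  by rewrite csn_nullZ// -vv2 csn_nullD.
rewrite expr2 -[RHS]mulr1 => /(mulfI v0) v1.
have [N2 [cs2 le2 vv0]] := csn_localise cs1 vs v1.
exists N2, (N x); split=> // [z|]; first exact: le_trans (le2 z) (le1 z).
have {}e0 : N2 (v * v - v) = 0 by exact: csn_leq0 e0.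
have v10 : N2 (1 - v) = 0.
  have -> : 1 - v = (1 - v * v) + (v * v - v) by rewrite addrA subrK.
  by rewrite csn_nullD.
rewrite {1}xE -scalerBr csn_nullZ// -csnN// opprB.
by rewrite yE opprB opprD addrA addrACA csn_nullD.
Qed.

(** Localising at the normalised [star b * b] forces its seminorm to be 1 under every further
    decrease, so later localisations cannot lose the norm of [b]. *)
Lemma csn_norming b : b != 0 ->
  exists N, cstar_seminorm N /\
    forall N', cstar_seminorm N' -> (forall z, N' z <= N z) -> N' b = nr b.
Proof.
move=> b0; have A1 : (1 : A) != 0.
  by apply: contra_neq b0 => A0; rewrite -(mulr1 b) A0 mulr0.
have nb0 : nr b != 0 by apply: contra_neq b0 => /nr_eq0.
have nb : 0 < nr b by rewrite lt_def nb0 nr_ge0.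
have csN := csn_nr A1.
pose p := (nr b ^- 2)%:C *: (star b * b).
have ps : star p = p by rewrite star_real star_mul starK.
have p1 : nr p = 1.
  rewrite (csnZR csN) ger0_norm ?invr_ge0 ?exprn_ge0 ?nr_ge0//.
  by rewrite nr_starM mulVf// expf_neq0.
have [N [cs le pp0]] := csn_localise csN ps p1.
exists N; split=> // N' cs' le'.
have {}pp0 : N' (1 - p * p) = 0 by exact: csn_leq0 pp0.
have := csn_null_eq cs' pp0; rewrite (csn1 cs') csn_sqr// => /esym/eqP.
rewrite sqrp_eq1 ?(csn_ge0 cs')// (csnZR cs') (csn_starM cs').
rewrite ger0_norm ?invr_ge0 ?exprn_ge0 ?nr_ge0// => /eqP p'.
apply/eqP; rewrite -(eqrXn2 (n := 2))// ?csn_ge0 ?nr_ge0//.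
have n2 : nr b ^+ 2 != 0 by rewrite expf_neq0.
by apply/eqP/(mulfI (invr_neq0 n2)); rewrite p' mulVf.
Qed.

(** With [w = 1 - l] the equation reads [l + l = z + l * l], solved by iterating from 0. The same
    recursion in [R] with [z = 1] stays in [[0, 1]] and serves as majorant, which covers the
    boundary case [nr z = 1]. *)
Lemma csn_sqrt z : nr z <= 1 -> exists w, w * w = 1 - z /\
  (star z = z -> star w = w).
Proof.
move=> z1; pose half : R[i] := (2^-1 : R)%:C.
have nh : nr half = 2^-1 by rewrite nrR ger0_norm ?invr_ge0.
pose fix y n : A := if n is m.+1 then half *: (z + y m * y m) else 0.
pose fix r n : R := if n is m.+1 then 2^-1 * (1 + r m * r m) else 0.
have r01 n : 0 <= r n <= 1.
  elim: n => [|n /andP[r0 r1]]; rewrite /= ?lexx ?ler01//.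
  have := mulr_ile1 r0 r0 r1 r1; have := mulr_ge0 r0 r0; lra.
have nyr n : nr (y n) <= r n.
  elim: n => [|n IH]; first by rewrite nr0.
  rewrite nrZ nh ler_wpM2l ?invr_ge0//.
  rewrite (le_trans (nrD _ _))// lerD// (le_trans (nr_mul _ _))//.
  by rewrite ler_pM ?nr_ge0.
have dy n : nr (y n.+1 - y n) <= r n.+1 - r n.
  elim: n => [|n IH].
    rewrite /= subr0 mulr0 addr0 subr0 mulr0 addr0 nrZ nh.
    by rewrite ler_wpM2l ?invr_ge0.
  have -> : y n.+2 - y n.+1 = half *: ((y n.+1 - y n) * (y n.+1 + y n)).
    by rewrite comm_sqrB [LHS]/= -scalerBr opprD addrACA subrr add0r.
  have -> : r n.+2 - r n.+1 = 2^-1 * ((r n.+1 - r n) * (r n.+1 + r n)).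
    suff E (a b : R) : 2^-1 * (1 + a * a) - 2^-1 * (1 + b * b) =
      2^-1 * ((a - b) * (a + b)) by exact: E.
    by ring.
  rewrite nrZ nh ler_wpM2l ?invr_ge0// (le_trans (nr_mul _ _))//.
  rewrite ler_pM ?nr_ge0// (le_trans (nrD _ _))// lerD//.
have [l [_ yl]] := nr_dominated_cvg dy (fun n => proj2 (andP (r01 n))).
have lE : l + l = z + l * l.
  apply/eqP; rewrite -subr_eq0; apply/eqP.
  (* The 2 counts two copies of [y n0.+1 - l]; [1 + nr l] bounds the norm of [y n0 + l]. *)
  apply: (@nr_le_eps _ _ _ (2 + (1 + nr l))) => e e0.
  have [n0 yn] := yl e e0.
  have -> : l + l - (z + l * l) =
      (y n0 - l) * (y n0 + l) - ((y n0.+1 - l) + (y n0.+1 - l)).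
    have yy : y n0.+1 + y n0.+1 = z + y n0 * y n0.
      rewrite /= -scalerDl -rmorphD/=.
      have -> : 2^-1 + 2^-1 = 1 :> R by lra.
      by rewrite scale1r.
    rewrite comm_sqrB addrACA yy; suff E (a b c : cA) :
      a + a - (b + a * a) = c - a * a - (b + c + (- a - a)).
      exact: E.
    by ring.
  rewrite (le_trans (nrD _ _))// nrN [leLHS]addrC [leRHS]mulrDl lerD//.
    rewrite (le_trans (nrD _ _))// mulr_natl mulr2n.
    by rewrite lerD// yn// ltnW.
  rewrite (le_trans (nr_mul _ _))// mulrC ler_pM ?nr_ge0//; last exact: yn.
  rewrite (le_trans (nrD _ _))// lerD2r (le_trans (nyr _))//.
  by case/andP: (r01 n0).
exists (1 - l); split.
  suff E (a b : cA) : a + a = b + a * a -> (1 - a) * (1 - a) = 1 - b.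
    exact: E lE.
  move=> E; have -> : b = a + a - a * a by rewrite E addrK.
  by ring.
move=> zs; rewrite starB star1; congr (1 - _).
have ys n : star (y n) = y n.
  elim: n => [|n IH]; first by rewrite /= star0.
  by rewrite /= star_real starD star_mul IH zs.
apply/eqP; rewrite -subr_eq0; apply/eqP.
apply: (@nr_le_eps _ _ _ 2) => e e0.
have [n0 yn] := yl e e0.
rewrite -[X in nr X](subrKA (y n0)) (le_trans (nrD _ _))//.
rewrite mulr_natl mulr2n lerD ?yn//.
by rewrite -nrN opprB -nr_star starB starK ys yn.
Qed.

(** * Vanishing of derivations on a commutative C*-algebra *)

Section derivation.
Variable D : A -> A.
Hypothesis DD : forall x y, D (x + y) = D x + D y.
Hypothesis DZ : forall l x, D (l *: x) = l *: D x.
Hypothesis DM : forall x y, D (x * y) = D x * y + x * D y.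

Let D1 : D 1 = 0.
Proof.
by have := DM 1 1; rewrite !(mulr1, mul1r) -{1}[D 1]addr0 => /addrI.
Qed.

Let DN x : D (- x) = - D x.
Proof. by rewrite -scaleN1r DZ scaleN1r. Qed.

(* If [u] is within [N]-distance zero of a scalar [l] of modulus one, then
   [1 - l^* u] is the square of an [N]-null element, so the Leibniz rule makes
   [D u] null; no continuity of [D] is involved. *)
Let D_unitary_null N u l : cstar_seminorm N -> nr u <= 1 -> nr l = 1 ->
  N (u - l *: (1 : A)) = 0 -> N (D u) = 0.
Proof.
move=> csN u1 l1 ul0.
have ll : Num.conj l * l = 1 by rewrite nr_sqr l1 expr1n.
have z1 : nr (Num.conj l *: u) <= 1 by rewrite nrZ nr_conj l1 mul1r.
have [w [ww _]] := csn_sqrt z1.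
have w0 : N w = 0.
  apply: csn_null_sqr => //; rewrite ww -csnN// opprB.
  have -> : Num.conj l *: u - 1 = Num.conj l *: (u - l *: (1 : A)).
    by rewrite scalerBr scalerA ll scale1r.
  exact: csn_nullZ.
have -> : u = l *: (1 - w * w).
  by rewrite ww opprB addrC subrK scalerA mulrC ll scale1r.
rewrite DZ DD DN D1 add0r DM csn_nullZ// csnN// csn_nullD//.
  by rewrite commA csn_null_mul.
by rewrite csn_null_mul.
Qed.

(** Here [f] is the real part of the unitary [u = f + 'i *: v], where [v] is a square root of
    [1 - f * f]. At a seminorm norming [D f], decreased until [f] and [v] are scalars, [u] and
    [star u] are scalars of modulus one; their derivatives are null, hence so is [D f]. *)
Let D_sa_le1 f : star f = f -> nr f <= 1 -> D f = 0.
Proof.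
move=> fs f1; apply: contrapT => /eqP Df0.
have [N [csN Nb]] := csn_norming Df0.
have [N1 [t [cs1 le1 ft]]] := csn_scalar csN fs.
have ff1 : nr (f * f) <= 1.
  by rewrite (le_trans (nr_mul _ _))// mulr_ile1 ?nr_ge0.
have [v [vv vs]] := csn_sqrt ff1.
have {}vs : star v = v by apply: vs; rewrite star_mul fs.
have [N2 [s [cs2 le2 vs2]]] := csn_scalar cs1 vs.
have {}ft : N2 (f - t%:C *: (1 : A)) = 0 by exact: csn_leq0 ft.
pose u := f + 'i *: v; pose l := t%:C + 'i * s%:C.
have us : star u = f - 'i *: v by rewrite starD starZ conjCi vs fs scaleNr.
have uu : star u * u = 1.
  rewrite us comm_sqrB scaleAl scaleAr scalerA -(expr2 'i) sqrCi scaleN1r.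
  by rewrite opprK vv subrKC.
have A1 : (1 : A) != 0.
  by apply: contra_neq Df0 => A0; rewrite -(mulr1 (D f)) A0 mulr0.
have u1 : nr u = 1.
  apply/eqP; rewrite -sqrp_eq1 ?nr_ge0//.
  by rewrite -nr_starM uu nr1.
have ul : N2 (u - l *: (1 : A)) = 0.
  have -> : u - l *: (1 : A) =
      (f - t%:C *: (1 : A)) + 'i *: (v - s%:C *: (1 : A)).
    by rewrite scalerDl opprD addrACA scalerBr scalerA.
  by rewrite csn_nullD// csn_nullZ.
have l1 : nr l = 1.
  have := csn_null_eq cs2 ul; rewrite (csnZ cs2) (csn1 cs2) mulr1 => <-.
  by apply/eqP; rewrite -sqrp_eq1 ?csn_ge0// -(csn_starM cs2) uu (csn1 cs2).
have Du : N2 (D u) = 0 by apply: D_unitary_null ul => //; rewrite u1.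
have Dus : N2 (D (star u)) = 0.
  apply: (D_unitary_null (l := Num.conj l)) => //.
  - by rewrite nr_star u1.
  - by rewrite nr_conj.
  - by rewrite -(csn_star cs2) starB starK starZ conjCK star1.
have : N2 (D f) = 0.
  apply: (csn_nullMn (n := 1)) => //.
  have -> : D f *+ 2 = D u + D (star u).
    by rewrite -DD us addrACA subrr addr0 DD mulr2n.
  by rewrite csn_nullD.
rewrite Nb// => [|z]; last exact: le_trans (le2 z) (le1 z).
by move/nr_eq0/eqP; apply/negP.
Qed.

Lemma cstar_derivation_eq0 x : D x = 0.
Proof.
have sa f : star f = f -> D f = 0.
  move=> fs; have n1 : 0 < nr f + 1 by rewrite ltr_wpDl ?nr_ge0.
  have -> : f = (nr f + 1)%:C *: ((nr f + 1)^-1%:C *: f).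
    by rewrite scalerA -rmorphM/= mulfV ?lt0r_neq0// scale1r.
  rewrite DZ D_sa_le1 ?scaler0 ?star_real ?fs// nrZ nrR.
  by rewrite ger0_norm ?invr_ge0 ?(ltW n1)// ler_pdivrMl// mulr1 lerDl.
have xE : x + x = (x + star x) + 'i *: ('i *: (star x - x)).
  rewrite scalerA -expr2 sqrCi scaleN1r opprB addrACA [star x + _]addrC.
  by rewrite addNr addr0.
have : D (x + x) = 0.
  rewrite xE DD DZ !sa ?scaler0 ?addr0//.
    by rewrite starZ conjCi starB starK scaleNr -scalerN opprB.
  by rewrite starD starK addrC.
rewrite DD -mulr2n -scaler_nat => /eqP.
by rewrite scaler_eq0 pnatr_eq0/= => /eqP.
Qed.

End derivation.

Lemma csn_complex_scalar N x : cstar_seminorm N ->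
  exists N' (l : R[i]), [/\ cstar_seminorm N', (forall z, N' z <= N z) &
    N' (x - l *: (1 : A)) = 0].
Proof.
move=> csN; pose p := x + star x; pose q := 'i *: (star x - x).
have ps : star p = p by rewrite starD starK addrC.
have qs : star q = q.
  by rewrite starZ conjCi starB starK scaleNr -scalerN opprB.
have [N1 [t [cs1 le1 pt]]] := csn_scalar csN ps.
have [N2 [s [cs2 le2 qt]]] := csn_scalar cs1 qs.
have {}pt : N2 (p - t%:C *: (1 : A)) = 0 by exact: csn_leq0 pt.
pose l : R[i] := 2^-1 * (t%:C + 'i * s%:C).
exists N2, l; split=> // [z|]; first exact: le_trans (le2 z) (le1 z).
apply: (csn_nullMn (n := 1)) => //.
have -> : (x - l *: (1 : A)) *+ 2 =
    (p - t%:C *: (1 : A)) + 'i *: (q - s%:C *: (1 : A)).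
  have xE : x *+ 2 = p + 'i *: q.
    rewrite scalerA -expr2 sqrCi scaleN1r opprB addrACA [star x + _]addrC.
    by rewrite addNr addr0 mulr2n.
  have lE : (l *: (1 : A)) *+ 2 = t%:C *: (1 : A) + 'i *: (s%:C *: (1 : A)).
    rewrite scalerMnl -mulr_natl mulrA mulfV ?pnatr_eq0// mul1r scalerDl.
    by rewrite scalerA.
  by rewrite mulrnBl xE lE scalerBr opprD addrACA.
by rewrite csn_nullD// csn_nullZ.
Qed.

(** An inverse would make 1 a multiple of a null element, against [csn1]. This turns positivity of
    inner products into a sign of scalars. *)
Lemma csn_null_spectrum N p l : cstar_seminorm N -> N (p - l *: (1 : A)) = 0 ->
  spectrum p l.
Proof.
move=> csN pl [b [pb _]]; have := csn1 csN; rewrite -pb csn_null_mul//.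
by move/esym/eqP; rewrite oner_eq0.
Qed.

(** Partial sums of the geometric series; the majorant carries the factor [nr 1], which is 0 in the
    trivial algebra. *)
Lemma neumann z : nr z <= 2^-1 -> exists b, (1 - z) * b = 1.
Proof.
move=> z1; pose fix y n : A := if n is m.+1 then 1 + z * y m else 0.
pose r n : R := nr (1 : A) * (2 - 2 * 2^-1 ^+ n).
have dy n : nr (y n.+1 - y n) <= r n.+1 - r n.
  have -> : r n.+1 - r n = nr (1 : A) * 2^-1 ^+ n.
    by rewrite /r exprS; field.
  elim: n => [|n IH]; first by rewrite /= mulr0 addr0 subr0 expr0 mulr1.
  have -> : y n.+2 - y n.+1 = z * (y n.+1 - y n).
    by rewrite [LHS]/= opprD addrACA subrr add0r mulrBr.
  rewrite (le_trans (nr_mul _ _))// exprS mulrCA.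
  by rewrite ler_pM ?nr_ge0.
have rB n : r n <= nr (1 : A) * 2.
  by rewrite /r ler_wpM2l ?nr_ge0// gerBl mulr_ge0 ?exprn_ge0 ?invr_ge0.
have [l [_ yl]] := nr_dominated_cvg dy rB.
exists l; rewrite mulrBl mul1r; apply/eqP; rewrite -subr_eq0; apply/eqP.
apply: (@nr_le_eps _ _ _ 2) => e e0; have [n0 yn] := yl e e0.
have -> : l - z * l - 1 = z * (y n0 - l) - (y n0.+1 - l).
  rewrite /= mulrBr; suff E (a b c : cA) :
    a - b - 1 = c - b - (1 + c - a) by exact: E.
  by ring.
rewrite (le_trans (nrD _ _))// nrN mulr_natl mulr2n.
apply: lerD; last exact/yn/leqnSn.
rewrite (le_trans (nr_mul _ _))// -[e]mul1r.
apply: ler_pM; rewrite ?nr_ge0//; last exact: yn.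
by rewrite (le_trans z1)// invf_le1// ler1n.
Qed.

End seminorm.

(** * Hilbert modules *)

Section hilbert_module.
Variables (R : realType) (A : cstarAlgType R) (M : hilbertModType A).
Implicit Types (a b : A) (x y z : M) (l : R[i]).

Lemma innerDl x y z : inner (x + y) z = inner x z + inner y z.
Proof. by have := inner_linear 1 x y z; rewrite !scale1r. Qed.

Lemma inner0l z : inner (0 : M) z = 0.
Proof. by apply: (addrI (inner 0 z)); rewrite -innerDl !addr0. Qed.

Lemma innerZl l x z : inner (l *: x) z = l *: inner x z.
Proof. by have := inner_linear l x 0 z; rewrite !addr0 inner0l addr0. Qed.

Lemma innerNl x z : inner (- x) z = - inner x z.
Proof. by rewrite -scaleN1r innerZl scaleN1r. Qed.

Lemma innerBl x y z : inner (x - y) z = inner x z - inner y z.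
Proof. by rewrite innerDl innerNl. Qed.

Lemma innerZr l x y : inner x (l *: y) = Num.conj l *: inner x y.
Proof. by rewrite inner_star innerZl starZ -inner_star. Qed.

Lemma innerBr x y z : inner x (y - z) = inner x y - inner x z.
Proof. by rewrite inner_star innerBl starB -!inner_star. Qed.

Lemma inner0r x : inner x (0 : M) = 0.
Proof. by rewrite inner_star inner0l star0. Qed.

Lemma inner_hactr a x y : inner x (hact a y) = inner x y * star a.
Proof. by rewrite inner_star inner_hact star_mul -inner_star. Qed.

Lemma nr_inner x : nr (inner x x) = nr x ^+ 2.
Proof.
apply: complexI; rewrite rmorphXn/= -!nrE hilbert_norm.
by rewrite sqrtCK.
Qed.

Lemma hact0l x : hact (0 : A) x = 0.
Proof. by apply: (addrI (hact 0 x)); rewrite -hactDl !addr0. Qed.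

Lemma hact_suml (n : nat) (F : 'I_n -> A) x :
  hact (\sum_(i < n) F i) x = \sum_(i < n) hact (F i) x.
Proof.
apply: (big_morph (fun a => hact a x)) => [a b|]; first exact: hactDl.
exact: hact0l.
Qed.

Lemma nr_hact a x : nr (hact a x) <= nr a * nr x.
Proof.
rewrite -(@ler_pXn2r _ 2)// ?nnegrE ?mulr_ge0 ?nr_ge0//.
rewrite -nr_inner inner_hact inner_hactr exprMn.
rewrite (le_trans (nr_mul _ _))// expr2 -mulrA ler_wpM2l ?nr_ge0//.
by rewrite (le_trans (nr_mul _ _))// nr_star nr_inner mulrC.
Qed.

Lemma hmod_endo_intro (T : M -> M) (C : R) : linear T ->
  (forall a x, T (hact a x) = hact a (T x)) ->
  (forall x, nr (T x) <= C * nr x) -> is_hmod_endo T.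
Proof.
move=> lT aT bT; split=> //; exists C%:C => x.
by rewrite !nrE -rmorphM/= lecR.
Qed.

(** The given bound [k] is just an element of [R[i]], but its product with the norm of [x] is
    nonnegative, so [k] may be replaced by its modulus. *)
Lemma hmod_endo_bound (T : 'End_A(M)) : exists C : R,
  0 <= C /\ forall x, nr (T x) <= C * nr x.
Proof.
have [_ _ [k kT]] := hmod_endoP T; exists (nr k); split; first exact: nr_ge0.
move=> x; rewrite -lecR rmorphM/= -!nrE (le_trans (kT x))//.
have : 0 <= k * `|x| by exact: le_trans (kT x).
by move/ger0_norm => <-; rewrite normrM normr_id.
Qed.

Definition mk_endo (T : M -> M) (TP : is_hmod_endo T) : 'End_A(M) :=
  HmodEndo (asboolT TP : T \in @hmod_endo_pred R A M).

Lemma hmod_endo_ext (S T : 'End_A(M)) : (forall x, S x = T x) -> S = T.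
Proof. by move=> ST; apply: val_inj; apply: funext. Qed.

Lemma hmod_endo_lin (T : 'End_A(M)) l x y : T (l *: x + y) = l *: T x + T y.
Proof. by have [lT _ _] := hmod_endoP T; exact: lT. Qed.

Lemma hmod_endo_hact (T : 'End_A(M)) a x : T (hact a x) = hact a (T x).
Proof. by have [_ aT _] := hmod_endoP T; exact: aT. Qed.

Lemma hmod_endo_applyD (T : 'End_A(M)) x y : T (x + y) = T x + T y.
Proof. by have := hmod_endo_lin T 1 x y; rewrite !scale1r. Qed.

Lemma hmod_endo_apply0 (T : 'End_A(M)) : T 0 = 0.
Proof. by apply: (addrI (T 0)); rewrite -hmod_endo_applyD !addr0. Qed.

Lemma hmod_endo_sum (T : 'End_A(M)) (n : nat) (F : 'I_n -> M) :
  T (\sum_(i < n) F i) = \sum_(i < n) T (F i).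
Proof.
apply: (big_morph T) => [x y|]; first exact: hmod_endo_applyD.
exact: hmod_endo_apply0.
Qed.

Hypothesis commA : forall a b, a * b = b * a.

(* In a seminorm [N] that sends [inner x y] to a scalar [rho] of modulus
   [nr (inner x y)] and [inner (x - c y) (x - c y)] to a scalar [r], positivity
   gives [0 <= r], and the classical choice of [c] applies. *)
Lemma cauchy_schwarz x y : nr (inner x y) <= nr x * nr y.
Proof.
have [->|b0] := eqVneq (inner x y) 0.
  by rewrite nr0 mulr_ge0 ?nr_ge0.
have y0 : 0 < nr y.
  rewrite lt_def nr_ge0 andbT; apply: contra_neq b0 => /nr_eq0 ->.
  exact: inner0r.
set B := nr (inner x y).
have [N [csN Nb]] := csn_norming commA b0.
have [N1 [rho [cs1 le1 xy]]] := csn_complex_scalar commA (inner x y) csN.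
have rhoB : nr rho = B.
  by rewrite -[RHS](Nb N1)// (csn_null_eq cs1 xy) (csnZ cs1) (csn1 cs1) mulr1.
pose k := (nr y ^+ 2)^-1; pose c : R[i] := k%:C * rho.
pose p := inner (x - c *: y) (x - c *: y).
have [ps pge0] := inner_ge0 (x - c *: y).
have [N2 [r [cs2 le2 pr]]] := csn_scalar commA cs1 ps.
have r0 : 0 <= r by have := pge0 _ (csn_null_spectrum cs2 pr); rewrite ler0c.
have {}xy : N2 (inner x y - rho *: (1 : A)) = 0.
  exact: csn_leq0 cs2 le2 xy.
have yx : N2 (inner y x - Num.conj rho *: (1 : A)) = 0.
  by rewrite -(csn_star cs2) starB starZ conjCK star1 -inner_star.
have cr : Num.conj c * rho = (k * B ^+ 2)%:C.
  rewrite rmorphM/= -mulrA nr_sqr rhoB [RHS]rmorphM/=; congr (_ * _).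
  by rewrite conj_Creal//; apply/complex_realP; exists k.
have rc : c * Num.conj rho = (k * B ^+ 2)%:C.
  by rewrite -mulrA (mulrC rho) nr_sqr rhoB [RHS]rmorphM.
(* Moving the cross terms of [p] across evaluates [N2 s] through the scalar [r + 2 * (k * B ^+ 2)],
   while its two summands bound it by [nr x ^+ 2 + k * B ^+ 2]. *)
pose s := inner x x + (Num.conj c * c) *: inner y y.
have sp : s = p + Num.conj c *: inner x y + c *: inner y x.
  rewrite /p innerBl !innerBr !innerZr !innerZl scalerA.
  suff E (u v w t : comm_cstar commA) : u + t = u - v - (w - t) + v + w.
    exact: E.
  by ring.
have s0 : N2 (s - (r + 2 * (k * B ^+ 2))%:C *: (1 : A)) = 0.
  have -> : s - (r + 2 * (k * B ^+ 2))%:C *: (1 : A) =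
      (p - r%:C *: (1 : A)) + Num.conj c *: (inner x y - rho *: (1 : A))
      + c *: (inner y x - Num.conj rho *: (1 : A)).
    rewrite !scalerBr !scalerA cr rc sp.
    rewrite -[X in _ = X + _]addrACA -[RHS]addrACA -!opprD -!scalerDl.
    by rewrite -!rmorphD/= mulr_natl mulr2n addrA.
  by apply: csn_nullD => //; [apply: csn_nullD => //|]; apply: csn_nullZ.
have := csn_null_eq cs2 s0; rewrite (csnZR cs2) (csn1 cs2) mulr1.
have Nxx : N2 (inner x x) <= nr x ^+ 2 by rewrite -nr_inner (csn_le cs2).
have Nyy : N2 (inner y y) <= nr y ^+ 2 by rewrite -nr_inner (csn_le cs2).
have cc : nr (Num.conj c * c) = k ^+ 2 * B ^+ 2.
  rewrite nrM nr_conj -expr2 nrM nrR exprMn rhoB ger0_norm//.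
  by rewrite invr_ge0 exprn_ge0// nr_ge0.
have Ns : N2 s <= nr x ^+ 2 + k * B ^+ 2.
  rewrite (le_trans (csnD cs2 _ _))// lerD// (csnZ cs2) cc.
  have -> : k * B ^+ 2 = k ^+ 2 * B ^+ 2 * nr y ^+ 2.
    by rewrite /k; field; rewrite lt0r_neq0.
  by rewrite ler_wpM2l// mulr_ge0 ?sqr_ge0.
move=> sE; have rB : r + 2 * (k * B ^+ 2) <= nr x ^+ 2 + k * B ^+ 2.
  by rewrite (le_trans _ Ns)// sE ler_norm.
have kB : k * B ^+ 2 <= nr x ^+ 2 by lra.
rewrite -(@ler_pXn2r _ 2)// ?nnegrE ?mulr_ge0 ?nr_ge0//.
by rewrite exprMn -ler_pdivrMr ?exprn_gt0// mulrC.
Qed.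

(* Uniform boundedness by a gliding hump: if [nr (T (x n)) > 6 ^ n * nr (x n)]
   for all [n], then the vector [y] is built so that its [n]-th increment, of
   norm [3 ^- n], makes [inner y (T (x n))] large and the later ones, of total
   norm at most [3 ^- n / 2], cannot undo this. *)
Lemma weakly_bounded_bounded (T : M -> M) : T 0 = 0 ->
  (forall y, exists C : R, forall x, nr (inner y (T x)) <= C * nr x) ->
  exists C : R, forall x, nr (T x) <= C * nr x.
Proof.
move=> T0 wb; apply: contrapT => unb.
have /choice[x xP] n : exists x, 6 ^+ n * nr x < nr (T x).
  apply: contrapT => H; apply: unb; exists (6 ^+ n) => x.
  by rewrite leNgt; apply/negP => lt; apply: H; exists x.
pose w n := T (x n).
have w0 n : 0 < nr (w n).
  by rewrite (le_lt_trans _ (xP n))// mulr_ge0 ?nr_ge0// exprn_ge0.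
have x0 n : 0 < nr (x n).
  rewrite lt_def nr_ge0 andbT; apply/eqP => /nr_eq0 xn0.
  by have := w0 n; rewrite /w xn0 T0 nr0 ltxx.
pose v n : M := (3 ^- n / nr (w n))%:C *: w n.
have nv n : nr (v n) = 3 ^- n.
  rewrite nrZ nrR ger0_norm ?mulr_ge0 ?invr_ge0 ?exprn_ge0 ?nr_ge0//.
  by rewrite -mulrA mulVf ?mulr1// lt0r_neq0.
have vw n : nr (inner (v n) (w n)) = 3 ^- n * nr (w n).
  rewrite innerZl nrZ nrR ger0_norm; last first.
    by rewrite mulr_ge0 ?invr_ge0 ?exprn_ge0 ?nr_ge0.
  rewrite nr_inner expr2 -!mulrA; congr (_ * _).
  by rewrite mulrA mulVf ?mul1r// lt0r_neq0.
pose good n y := 3 ^- n * nr (w n) <= nr (inner (y + v n) (w n)).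
pose fix y n : M := if n is m.+1 then
  if good m (y m) then y m + v m else y m - v m else 0.
(* The values at [y n + v n] and [y n - v n] differ by twice [inner (v n) (w n)], so one of the two
   signs succeeds. *)
have yw n : 3 ^- n * nr (w n) <= nr (inner (y n.+1) (w n)).
  rewrite /=; case: ifPn => //; rewrite /good -ltNge => bad.
  have : nr (inner (v n) (w n) *+ 2) <=
      nr (inner (y n + v n) (w n)) + nr (inner (y n - v n) (w n)).
    rewrite -(nrN (inner (y n - v n) (w n))).
    suff -> : inner (v n) (w n) *+ 2 =
      inner (y n + v n) (w n) - inner (y n - v n) (w n) by exact: nrD.
    by rewrite -innerBl opprB addrC addrA subrK innerDl mulr2n.
  rewrite -scaler_nat nrZ vw.
  have -> : nr (2%:R : R[i]) = 2.
    by rewrite /nr normr_nat -(rmorph_nat (real_complex R)).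
  by move: bad; lra.
pose r n : R := 3 / 2 - 3 / 2 * 3 ^- n.
have rS n : r n.+1 - r n = 3 ^- n.
  by rewrite /r exprS invfM; lra.
have dy n : nr (y n.+1 - y n) <= r n.+1 - r n.
  rewrite rS -nv /=; case: ifPn => _; rewrite addrAC subrr add0r// nrN.
  exact: lexx.
have rB n : r n <= 3 / 2.
  by rewrite /r gerBl mulr_ge0 ?divr_ge0 ?invr_ge0 ?exprn_ge0.
have [l [yl _]] := nr_dominated_cvg dy rB.
have [C CP] := wb l.
(* Half of [3 ^- n] survives in the limit; against the growth [6 ^+ n] this leaves [2 ^+ n / 2],
   which is unbounded. *)
have lw n : 2^-1 * 2 ^+ n <= C.
  have half_w : 2^-1 * (3 ^- n * nr (w n)) <= nr (inner l (w n)).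
    have := nrD (inner (y n.+1 - l) (w n)) (inner l (w n)).
    rewrite innerBl subrK => tri.
    have : nr (inner (y n.+1) (w n) - inner l (w n)) <=
        2^-1 * 3 ^- n * nr (w n).
      rewrite -innerBl (le_trans (cauchy_schwarz _ _))//.
      rewrite ler_wpM2r ?nr_ge0// (le_trans (yl _))// /r exprS invfM.
      by rewrite opprB addrC subrK; lra.
    have := yw n; move: tri; rewrite -mulrA; lra.
  rewrite -(ler_pM2r (x0 n)) (le_trans _ (CP _))// (le_trans _ half_w)//.
  rewrite -mulrA ler_wpM2l ?invr_ge0// ler_pdivlMl ?exprn_gt0//.
  by rewrite mulrA -exprMn -natrM; exact: ltW (xP n).
have := upper_nthrootP (leqnn (Num.bound (2 * C))).
by rewrite ltNge => /negP; apply; rewrite -ler_pdivrMl.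
Qed.

Hypothesis fullM : full M.

(** Some element of the span lies within 1/2 of 1, hence is invertible; its inverse and the scalars
    are absorbed into the left-hand vectors. *)
Lemma full_unit_sum : exists (n : nat) (z y : 'I_n -> M),
  \sum_(i < n) inner (z i) (y i) = 1.
Proof.
have : closure (@inner_span R A M) 1 by rewrite fullM.
have h0 : (0 : R[i]) < (2^-1 : R)%:C by rewrite (ltcR 0) invr_gt0.
move=> /(_ _ (nbhsx_ballx _ _ h0))[c [[n [l [x [y cE]]]]]].
rewrite -ball_normE /ball_/= nrE ltcR => /ltW/neumann.
move=> /(_ commA)[b cb].
exists n, (fun i => hact b (l i *: x i)), y.
rewrite -cb opprB addrC subrK commA cE mulr_sumr.
by apply: eq_bigr => i _; rewrite inner_hact innerZl.
Qed.

End hilbert_module.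

(** * Derivations of the endomorphism algebra *)

Section derivations.
Variables (R : realType) (A : cstarAlgType R) (M : hilbertModType A).
Hypothesis commA : forall a b : A, a * b = b * a.
Implicit Types (a b : A) (u x y z : M) (l : R[i]) (S T : 'End_A(M)).

Fact rank_one_subproof u y : is_hmod_endo (fun x => hact (inner x y) u).
Proof.
apply: (@hmod_endo_intro _ _ _ _ (nr y * nr u)) => [l x z|a x|x].
- by rewrite inner_linear hactDl hactZl.
- by rewrite inner_hact hactM.
- rewrite (le_trans (nr_hact _ _))// mulrAC ler_wpM2r ?nr_ge0// mulrC.
  exact: cauchy_schwarz.
Qed.

Definition rank_one u y : 'End_A(M) := mk_endo (rank_one_subproof u y).

Lemma rank_oneE u y x : rank_one u y x = hact (inner x y) u.
Proof. by []. Qed.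

Fact scalar_endo_subproof a : is_hmod_endo (fun x : M => hact a x).
Proof.
apply: (@hmod_endo_intro _ _ _ _ (nr a)) => [l x z|b x|x].
- by rewrite hactDr hactZr.
- by rewrite -!hactM commA.
- exact: nr_hact.
Qed.

Definition scalar_endo a : 'End_A(M) := mk_endo (scalar_endo_subproof a).

Lemma scalar_endoE a x : scalar_endo a x = hact a x.
Proof. by []. Qed.

Lemma scalar_endo_central a S : scalar_endo a * S = S * scalar_endo a.
Proof.
by apply: hmod_endo_ext => x; rewrite !hmod_endoM !scalar_endoE hmod_endo_hact.
Qed.

Lemma mul_rank_one S u y : S * rank_one u y = rank_one (S u) y.
Proof.
by apply: hmod_endo_ext => x; rewrite hmod_endoM !rank_oneE hmod_endo_hact.
Qed.

Hypothesis fullM : full M.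
Variable d : 'End_A(M) -> 'End_A(M).
Hypothesis derd : derivation d.

Let dD S T : d (S + T) = d S + d T.
Proof. by have [lin _] := derd; have := lin 1 S T; rewrite !scale1r. Qed.

Let d0 : d 0 = 0.
Proof. by apply: (addrI (d 0)); rewrite -dD !addr0. Qed.

Let dZ l S : d (l *: S) = l *: d S.
Proof. by have [lin _] := derd; have := lin l S 0; rewrite d0 !addr0. Qed.

Let dM S T : d (S * T) = d S * T + S * d T.
Proof. by have [_ ->] := derd. Qed.

(* [d (scalar_endo a)] commutes with everything, hence is [scalar_endo (D a)]
   for a derivation [D] of [A]. *)
Lemma derivation_scalar_endo a : d (scalar_endo a) = 0.
Proof.
have [n [z [y zy1]]] := full_unit_sum commA fullM.
pose D b := \sum_(i < n) inner (d (scalar_endo b) (z i)) (y i).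
have central b S : d (scalar_endo b) * S = S * d (scalar_endo b).
  have := congr1 d (scalar_endo_central b S).
  by rewrite !dM (scalar_endo_central b (d S)) addrC => /addrI.
(* As [x] is the sum of the [rank_one x (y i) (z i)], commuting with these operators transfers the
   action from [x] to the [z i]. *)
have DE b x : d (scalar_endo b) x = hact (D b) x.
  rewrite -{1}[x]hact1 -zy1 hact_suml hmod_endo_sum hact_suml.
  apply: eq_bigr => i _; rewrite -rank_oneE -hmod_endoM central.
  by rewrite hmod_endoM rank_oneE.
(* Fullness makes the action of [A] faithful, so the laws of a derivation can be checked on
   operators. *)
have Duniq b c : (forall x, d (scalar_endo b) x = hact c x) -> D b = c.
  move=> bc; rewrite -[c]mulr1 -zy1 mulr_sumr; apply: eq_bigr => i _.
  by rewrite bc inner_hact.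
have D0 : D a = 0.
  apply: (cstar_derivation_eq0 commA) => [b c|l b|b c]; apply: Duniq => x.
  - have -> : scalar_endo (b + c) = scalar_endo b + scalar_endo c.
      by apply: hmod_endo_ext => v; rewrite hmod_endoD !scalar_endoE hactDl.
    by rewrite dD hmod_endoD !DE hactDl.
  - have -> : scalar_endo (l *: b) = l *: scalar_endo b.
      by apply: hmod_endo_ext => v; rewrite hmod_endoZ !scalar_endoE hactZl.
    by rewrite dZ hmod_endoZ DE hactZl.
  - have -> : scalar_endo (b * c) = scalar_endo b * scalar_endo c.
      by apply: hmod_endo_ext => v; rewrite hmod_endoM !scalar_endoE hactM.
    rewrite dM hmod_endoD !hmod_endoM !DE !scalar_endoE.
    by rewrite hactDl !hactM.
by apply: hmod_endo_ext => x; rewrite DE D0 hact0l.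
Qed.

Lemma derivation_inner : inner_derivation d.
Proof.
have [n [z [y zy1]]] := full_unit_sum commA fullM.
pose t x := \sum_(i < n) d (rank_one x (y i)) (z i).
(* Leibniz for [S * rank_one x (y i)], evaluated at [z i] and summed; the vectors
   [rank_one x (y i) (z i)] add up to [x]. *)
have tS S x : t (S x) = d S x + S (t x).
  rewrite /t hmod_endo_sum -{2}[x]hact1 -zy1 hact_suml hmod_endo_sum.
  rewrite -big_split/=; apply: eq_bigr => i _.
  by rewrite -mul_rank_one dM hmod_endoD !hmod_endoM rank_oneE.
have tlin : linear t.
  move=> l x v; rewrite /t scaler_sumr -big_split/=; apply: eq_bigr => i _.
  have -> : rank_one (l *: x + v) (y i) =
      l *: rank_one x (y i) + rank_one v (y i).
    apply: hmod_endo_ext => c; rewrite hmod_endoD hmod_endoZ !rank_oneE.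
    by rewrite hactDr hactZr.
  by rewrite dD dZ hmod_endoD hmod_endoZ.
have tact a x : t (hact a x) = hact a (t x).
  by have := tS (scalar_endo a) x; rewrite derivation_scalar_endo add0r.
have tB x v : t (x - v) = t x - t v.
  by rewrite addrC -scaleN1r tlin scaleN1r addrC.
have [C tC] : exists C : R, forall x, nr (t x) <= C * nr x.
  apply: (weakly_bounded_bounded commA) => [|v].
    by have := tB 0 0; rewrite !subrr.
  have /choice[K KP] i : exists K : R, forall x,
      nr (hact (inner (t x) v) (z i)) <= K * nr x.
    have [K [K0 KP]] := hmod_endo_bound (d (rank_one (z i) v)).
    exists (nr v * nr (t (z i)) + K) => x.
    have -> : hact (inner (t x) v) (z i) =
        hact (inner x v) (t (z i)) - d (rank_one (z i) v) x.
      have := tS (rank_one (z i) v) x; rewrite !rank_oneE tact => ->.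
      by rewrite addrC addKr.
    rewrite (le_trans (nrD _ _))// nrN mulrDl lerD//.
    rewrite (le_trans (nr_hact _ _))// mulrAC ler_wpM2r ?nr_ge0// mulrC.
    exact: cauchy_schwarz.
  (* Inserting [1] as the sum of the [inner (z i) (y i)] recovers [inner (t x) v] from its action on
     the [z i], bounded just above. *)
  exists (\sum_(i < n) K i * nr (y i)) => x.
  rewrite inner_star nr_star -[inner _ _]mulr1 -zy1 mulr_sumr mulr_suml.
  rewrite (le_trans (nr_sum _))// ler_sum// => i _; rewrite -inner_hact.
  rewrite (le_trans (cauchy_schwarz commA _ _))// mulrAC.
  by rewrite ler_wpM2r ?nr_ge0.
exists (mk_endo (hmod_endo_intro tlin tact tC)) => S.
apply: hmod_endo_ext => x; rewrite hmod_endoD hmod_endoN !hmod_endoM.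
by rewrite [mk_endo _ (S x)]tS addrK.
Qed.

End derivations.

Theorem theorem2p3 (R : realType) (A : cstarAlgType R)
    (commA : forall a b : A, a * b = b * a)
    (M : hilbertModType A) (fullM : full M)
    (d : 'End_A(M) -> 'End_A(M)) (derd : derivation d) :
  inner_derivation d.
Proof. exact: derivation_inner. Qed.
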